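(* $\mathrm{ex}'(n,\{\text{nested},\text{ears},\text{david}\})\in O(n)$.
   Context: Let $P$ be a set of $n$ points in convex position in the plane (the vertices of a convex $n$-gon); a triangle on $P$ is a 3-element subset of $P$. For two distinct triangles $t_1,t_2$ on $P$, label each point of $t_1\cup t_2$ by the triangle(s) containing it and read the points in their cyclic order around the polygon. The pair forms exactly one of eight configurations. (i) If $t_1,t_2$ share two vertices $u,v$: ''taco'' if their third vertices lie on the same side of the line $uv$, ''mariposa'' if on opposite sides. (ii) If they share exactly one vertex $v$: read the remaining four vertices in cyclic order starting just after $v$; ''bat'' if the pattern is $t_1t_1t_2t_2$ or $t_2t_2t_1t_1$, ''nested'' if it is $t_1t_2t_2t_1$ or $t_2t_1t_1t_2$, ''crossing'' if it is $t_1t_2t_1t_2$ or $t_2t_1t_2t_1$. (iii) If they share no vertex, the cyclic sequence of the six labels is, up to rotation, reflection and exchanging the roles of $t_1,t_2$, one of: ''ears'' $AAABBB$, ''swords'' $AABABB$, ''david'' $ABABAB$. Top/bottom variant: partition the vertices of the convex $n$-gon by a horizontal line into a top half of $\lceil n/2\rceil$ vertices and a bottom half of $\lfloor n/2\rfloor$ vertices (each half consisting of consecutive vertices along the polygon). For a set $X$ of configurations, $\mathrm{ex}'(n,X)$ is the maximum size of a family of triangles on $P$, each having exactly two vertices in the top half and one vertex in the bottom half, in which no two triangles form a configuration belonging to $X$. *)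

(* Defs.v *)
From mathcomp Require Import all_boot.

Set Implicit Arguments.
Unset Strict Implicit.
Unset Printing Implicit Defensive.

(* The vertices of the convex n-gon are identified with 'I_n, numbered in      *)
(* their cyclic order around the polygon.                                      *)

Definition is_triangle n (t : {set 'I_n}) : bool := #|t| == 3.

(* The vertices lying strictly on one side of the line through u and v are     *)
(* those whose number is strictly between those of u and v; the remaining ones *)
(* lie on the other side.                                                      *)
Definition between n (u v x : 'I_n) : bool := minn u v < x < maxn u v.

Definition same_side n (u v x y : 'I_n) : bool :=
  between u v x == between u v y.

(* Label words: the letter true stands for t1 and false for t2. They are only  *)
(* used when every vertex that is read belongs to exactly one of t1, t2.       *)

Definition word_after n (v : 'I_n) (t1 t2 : {set 'I_n}) : seq bool :=
  [seq x \in t1 | x <- rot v.+1 (enum 'I_n) & x \in (t1 :|: t2) :\ v].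

Definition word n (t1 t2 : {set 'I_n}) : seq bool :=
  [seq x \in t1 | x <- enum 'I_n & x \in t1 :|: t2].

Definition same_cyclic_pattern (p w : seq bool) : bool :=
  [exists k : 'I_(size p),
    w \in [:: rot k p; rot k (rev p);
              map negb (rot k p); map negb (rot k (rev p))]].

Inductive configuration : Type :=
  Taco | Mariposa | Bat | Nested | Crossing | Ears | Swords | David.

Local Notation A := true.
Local Notation B := false.

Definition share_two n (side : bool) (t1 t2 : {set 'I_n}) : bool :=
  [exists u, exists v, exists x, exists y,
    [&& u != v, t1 :&: t2 == [set u; v],
        x \in t1 :\: t2, y \in t2 :\: t1 & same_side u v x y == side]].

Definition share_one n (ps : seq (seq bool)) (t1 t2 : {set 'I_n}) : bool :=
  [exists v, (t1 :&: t2 == [set v]) && (word_after v t1 t2 \in ps)].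

Definition share_none n (p : seq bool) (t1 t2 : {set 'I_n}) : bool :=
  (t1 :&: t2 == set0) && same_cyclic_pattern p (word t1 t2).

Definition forms n (c : configuration) (t1 t2 : {set 'I_n}) : bool :=
  match c with
  | Taco     => share_two true t1 t2
  | Mariposa => share_two false t1 t2
  | Bat      => share_one [:: [:: A; A; B; B]; [:: B; B; A; A]] t1 t2
  | Nested   => share_one [:: [:: A; B; B; A]; [:: B; A; A; B]] t1 t2
  | Crossing => share_one [:: [:: A; B; A; B]; [:: B; A; B; A]] t1 t2
  | Ears     => share_none [:: A; A; A; B; B; B] t1 t2
  | Swords   => share_none [:: A; A; B; A; B; B] t1 t2
  | David    => share_none [:: A; B; A; B; A; B] t1 t2
  end.

(* uphalf n is n/2 rounded up. *)
Definition top n : {set 'I_n} := [set i : 'I_n | i < uphalf n].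
Definition bottom n : {set 'I_n} := ~: top n.

Definition two_top_one_bottom n (t : {set 'I_n}) : bool :=
  (#|t :&: top n| == 2) && (#|t :&: bottom n| == 1).

(* The list X stands for the set of forbidden configurations. *)
Definition admissible n (X : seq configuration) (F : {set {set 'I_n}}) : bool :=
  [forall t in F, is_triangle t && two_top_one_bottom t] &&
  [forall t1 in F, forall t2 in F,
    (t1 != t2) ==> all (fun c => ~~ forms c t1 t2) X].

Definition ex' (n : nat) (X : seq configuration) : nat :=
  \max_(F : {set {set 'I_n}} | admissible X F) #|F|.

(* Main.v *)
Require Import Defs.
From mathcomp Require Import all_boot all_order all_algebra zify.

Set Implicit Arguments.
Unset Strict Implicit.
Unset Printing Implicit Defensive.

(** Write a triangle as (a, b, c) with base a < b in the top half and apex c in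
the bottom half.  Avoiding the three configurations makes the apex weakly
increasing in b for fixed a, in a for fixed b, and when the base moves to a
disjoint base on its right, but weakly decreasing when the base moves to a
crossing one on its right; and bases with a common apex are not strictly nested.

A triangle whose base is neither the longest one starting at a nor the longest
one ending at b is a corner: comparing it with a longer base at either end
forces all three apexes to be equal.  Hence a corner cannot have both a corner
with a longer base from a and one with a shorter base to b, as these two would
share an apex and be strictly nested, so there are at most 2n corners.

The bases that are longest from a, and those that are longest to b, number at
most n each.  In either family remove the lowest and the highest apex over each
base.  By monotonicity two of the remaining triangles with the same apex have
bases [a, b] and [b, d]; no three intervals are pairwise of this kind, so every
apex is left with at most two triangles. *)

(** * Elementary cardinality bounds *)

Lemma card_le_inj (aT rT : finType) (f : aT -> rT)
    (A : {set aT}) (B : {set rT}) :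
  {in A, forall x, f x \in B} -> {in A &, injective f} -> #|A| <= #|B|.
Proof.
move=> fAB injf; rewrite -(card_in_imset injf); apply: subset_leq_card.
by apply/subsetP=> _ /imsetP[x xA ->]; apply: fAB.
Qed.

Lemma card_le_fibers (aT rT : finType) (f : aT -> rT) (A : {set aT}) k :
  (forall y, #|[set x in A | f x == y]| <= k) -> #|A| <= k * #|rT|.
Proof.
move=> fib; rewrite -sum1_card (partition_big f predT) //=.
rewrite mulnC -[X in _ <= X * _]sum1_card big_distrl /=; apply: leq_sum => y _.
rewrite mul1n; apply: leq_trans (fib y); rewrite -sum1_card.
by apply/eq_leq/eq_bigl => x; rewrite inE.
Qed.

Lemma card_setU_le (T : finType) (A B : {set T}) : #|A :|: B| <= #|A| + #|B|.
Proof. by rewrite cardsU leq_subr. Qed.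

(** * Tame sets of base-apex triples and their size *)

Local Notation triple n := ('I_n * 'I_n * 'I_n)%type.

(** What avoidance says about bases and apexes: [tame_apex], [tame_left] and [tame_right] come from
    nested pairs sharing the apex, the left or the right base end, [tame_apart] from ears and
    [tame_cross] from david. *)
Record tame n (T : {set triple n}) : Prop := Tame {
  tame_lt a b c : (a, b, c) \in T -> a < b;
  tame_apex a b a' b' c : (a, b, c) \in T -> (a', b', c) \in T ->
    a < a' -> b <= b';
  tame_left a b b' c c' : (a, b, c) \in T -> (a, b', c') \in T ->
    b < b' -> c <= c';
  tame_right a a' b c c' : (a, b, c) \in T -> (a', b, c') \in T ->
    a < a' -> c <= c';
  tame_apart a b c a' b' c' : (a, b, c) \in T -> (a', b', c') \in T ->
    b < a' -> c <= c';
  tame_cross a b c a' b' c' : (a, b, c) \in T -> (a', b', c') \in T ->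
    a < a' -> a' < b -> b < b' -> c' <= c }.

Section Tame.
Variables (n : nat) (T : {set triple n}).
Hypothesis tT : tame T.

Definition apex_between : {set triple n} :=
  [set t in T | [exists c, ((t.1, c) \in T) && (c < t.2)] &&
                [exists c, ((t.1, c) \in T) && (t.2 < c)]].

(** Strictly nested bases are excluded by [tame_apex]. In every other position without touching,
    replacing the apex [c] of one triple by a higher or lower apex over the same base breaks the
    monotonicity rule for that position. *)
Lemma apex_between_touch a b a' b' c :
  (a, b, c) \in apex_between -> (a', b', c) \in apex_between ->
  (a, b) != (a', b') -> b = a' \/ b' = a.
Proof.
rewrite !inE /= => /and3P[t /existsP[x /andP[tx xc]] /existsP[y /andP[ty cy]]].
move=> /and3P[t' /existsP[x' /andP[tx' xc']] /existsP[y' /andP[ty' cy']]] nE.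
have lt := tame_lt tT t; have lt' := tame_lt tT t'.
have {nE} : (a != a' :> nat) || (b != b' :> nat) by rewrite -negb_and.
case: (ltngtP a a') => [aa'|a'a|/val_inj aE] /= nE.
- case: (ltngtP b a') => [ba'|a'b|/val_inj ->]; last by left.
    by have := tame_apart tT ty t' ba'; lia.
  case: (ltngtP b b') => [bb'|b'b|/val_inj bE].
  + by have := tame_cross tT tx t' aa' a'b bb'; lia.
  + by have := tame_apex tT t t' aa'; lia.
  + by subst b'; have := tame_right tT ty t' aa'; lia.
- case: (ltngtP b' a) => [b'a|ab'|/val_inj ->]; last by right.
    by have := tame_apart tT ty' t b'a; lia.
  case: (ltngtP b' b) => [bb'|b'b|/val_inj bE].
  + by have := tame_cross tT tx' t a'a ab' bb'; lia.
  + by have := tame_apex tT t' t a'a; lia.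
  + by subst b'; have := tame_right tT ty' t a'a; lia.
- subst a'; case: (ltngtP b b') nE => // bb' _.
  + by have := tame_left tT ty t' bb'; lia.
  + by have := tame_left tT ty' t bb'; lia.
Qed.

Lemma card_apex_between : #|apex_between| <= 2 * n.
Proof.
have := @card_le_fibers _ _ snd apex_between 2; rewrite card_ord; apply=> c.
rewrite leqNgt; apply/card_gt2P.
case=> -[[a1 b1] c1] [[[a2 b2] c2] [[[a3 b3] c3] [[t1 t2 t3] [n12 n23 n31]]]].
have atc t : t \in [set x in apex_between | x.2 == c] ->
    t \in apex_between /\ t.2 = c by rewrite inE => /andP[-> /eqP].
move: t1 t2 t3 => /atc/= [t1 E1] /atc/= [t2 E2] /atc/= [t3 E3]; subst c1 c2 c3.
have lt a b : (a, b, c) \in apex_between -> a < b.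
  by rewrite inE => /andP[/(tame_lt tT)].
have neq (a b a' b' : 'I_n) : (a, b, c) != (a', b', c) -> (a, b) != (a', b').
  by apply: contraNneq => ->.
have := lt _ _ t1; have := lt _ _ t2; have := lt _ _ t3.
(* Orient each touching pair from left to right. A cyclic orientation contradicts [a < b]; a
   transitive one forces the middle interval to have equal ends. *)
case: (apex_between_touch t1 t2 (neq _ _ _ _ n12)) => /(congr1 val)/= ?;
case: (apex_between_touch t2 t3 (neq _ _ _ _ n23)) => /(congr1 val)/= ?;
case: (apex_between_touch t3 t1 (neq _ _ _ _ n31)) => /(congr1 val)/= *; lia.
Qed.

(** As [f] determines the base, it is injective on the triples of lowest apex and on those of
    highest apex. These give [n] each, besides the [2 * n] of [apex_between]. *)
Lemma card_graph (S : {set triple n}) (f : triple n -> 'I_n) :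
  S \subset T -> {in S &, forall t t', f t = f t' -> t.1 = t'.1} ->
  #|S| <= 4 * n.
Proof.
move=> /subsetP sST fS.
pose lo := [set t in S | ~~ [exists c, ((t.1, c) \in T) && (c < t.2)]].
pose hi := [set t in S | ~~ [exists c, ((t.1, c) \in T) && (t.2 < c)]].
have split3 : S \subset apex_between :|: (lo :|: hi).
  by apply/subsetP=> t tS; rewrite !inE tS (sST t tS) /=; do 2!case: existsP.
have card_lo : #|lo| <= #|[set: 'I_n]|.
  apply: (@card_le_inj _ _ f) => // -[[a b] c] [[a' b'] c'].
  rewrite !inE /= => /andP[t mt] /andP[t' mt'] /(fS _ _ t t') /= E.
  case: E t' mt' => <- <- t' mt'; congr (_, _, _); apply: val_inj => /=.
  case: (ltngtP c c') => // cc'.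
    by case/existsP: mt'; exists c; rewrite sST.
  by case/existsP: mt; exists c'; rewrite sST.
have card_hi : #|hi| <= #|[set: 'I_n]|.
  apply: (@card_le_inj _ _ f) => // -[[a b] c] [[a' b'] c'].
  rewrite !inE /= => /andP[t mt] /andP[t' mt'] /(fS _ _ t t') /= E.
  case: E t' mt' => <- <- t' mt'; congr (_, _, _); apply: val_inj => /=.
  case: (ltngtP c c') => // cc'.
    by case/existsP: mt; exists c'; rewrite sST.
  by case/existsP: mt'; exists c; rewrite sST.
move: card_lo card_hi (subset_leq_card split3) card_apex_between.
have := card_setU_le apex_between (lo :|: hi); have := card_setU_le lo hi.
rewrite cardsT card_ord; lia.
Qed.

(** * Corners *)

Definition wider_left (S : {set triple n}) (t : triple n) :=
  [exists a, exists c, ((a, t.1.2, c) \in S) && (a < t.1.1)].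
Definition wider_right (S : {set triple n}) (t : triple n) :=
  [exists b, exists c, ((t.1.1, b, c) \in S) && (t.1.2 < b)].
Definition narrower_left (S : {set triple n}) (t : triple n) :=
  [exists a, exists c, ((a, t.1.2, c) \in S) && (t.1.1 < a)].

Lemma exists2ordP (P : 'I_n -> 'I_n -> bool) :
  reflect (exists a c, P a c) [exists a, exists c, P a c].
Proof.
apply: (iffP existsP) => [[a /existsP[c Pac]]|[a [c Pac]]];
  first by exists a, c.
by exists a; apply/existsP; exists c.
Qed.

(* For (a-, b, c1), (a, b, c), (a, b+, c2) with a- < a and b < b+ the chain
   c1 <= c <= c2 closes up to c2 <= c1, since the outer two bases cross. *)
Lemma corner_apex a b c a1 c1 b2 c2 :
  (a, b, c) \in T -> (a1, b, c1) \in T -> (a, b2, c2) \in T ->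
  a1 < a -> b < b2 -> c1 = c /\ c2 = c.
Proof.
move=> t t1 t2 a1a bb2.
have := tame_right tT t1 t a1a; have := tame_left tT t t2 bb2.
have := tame_cross tT t1 t2 a1a (tame_lt tT t) bb2.
by move=> *; split; apply: val_inj => /=; lia.
Qed.

Definition corners := [set t in T | wider_left T t && wider_right T t].

Lemma cornerP a b c : (a, b, c) \in corners ->
  [/\ (a, b, c) \in T,
      exists a1 c1, (a1, b, c1) \in T /\ a1 < a &
      exists b2 c2, (a, b2, c2) \in T /\ b < b2].
Proof.
rewrite inE => /and3P[t /exists2ordP[a1 [c1 /andP[t1 l1]]]].
move=> /exists2ordP[b2 [c2 /andP[t2 l2]]].
by split=> //; [exists a1, c1|exists b2, c2].
Qed.

(** The right extension in [corner_apex] is arbitrary, so the apex is forced over every longer base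
    from [a], not just over the one witnessing the corner. *)
Lemma corner_right a b c b' c' : (a, b, c) \in corners ->
  (a, b', c') \in T -> b < b' -> c' = c.
Proof.
move=> /cornerP[t [a1 [c1 [t1 l1]]] _] t' l'.
by case: (corner_apex t t1 t' l1 l').
Qed.

Lemma corner_left a b c a' c' : (a, b, c) \in corners ->
  (a', b, c') \in T -> a' < a -> c' = c.
Proof.
move=> /cornerP[t _ [b2 [c2 [t2 l2]]]] t' l'.
by case: (corner_apex t t' t2 l' l2).
Qed.

Lemma card_corners : #|corners| <= 2 * n.
Proof.
pose colmax := [set t in corners | ~~ wider_right corners t].
pose rowmax := [set t in corners | ~~ narrower_left corners t].
have cT t : t \in corners -> t \in T by rewrite inE => /andP[].
have split2 : corners \subset colmax :|: rowmax.
  apply/subsetP=> -[[a b] c] t; rewrite 2!inE [X in _ || X]inE t /=.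
  rewrite -negb_and; apply/negP.
  move=> /andP[/exists2ordP[/= b' [c1 /andP[t1 bb']]]].
  move=> /exists2ordP[/= a' [c2 /andP[t2 aa']]].
  have E1 := corner_right t (cT _ t1) bb'.
  (* Here the corner is [t2], and [t] supplies its longer base. So [t1] and [t2] share the apex [c],
     while the base of [t2] lies strictly inside that of [t1]. *)
  have E2 := corner_left t2 (cT _ t) aa'.
  subst c1 c2; have := tame_apex tT (cT _ t1) (cT _ t2) aa'; lia.
have card_col : #|colmax| <= #|[set: 'I_n]|.
  apply: (@card_le_inj _ _ (fun t => t.1.1)) => // -[[a b] c] [[a' b'] c'].
  move=> /setIdP[t mt] /setIdP[t' mt'] /= E.
  subst a'; have E : b = b'.
    apply: val_inj => /=; case: (ltngtP b b') => // bb'.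
      by case/exists2ordP: mt; exists b', c'; rewrite t'.
    by case/exists2ordP: mt'; exists b, c; rewrite t.
  (* Both candidate apexes over the common base equal the apex of one and the same longer base. *)
  subst b'; have [_ _ [b2 [c2 [t2 l2]]]] := cornerP t.
  by rewrite -(corner_right t t2 l2) -(corner_right t' t2 l2).
have card_row : #|rowmax| <= #|[set: 'I_n]|.
  apply: (@card_le_inj _ _ (fun t => t.1.2)) => // -[[a b] c] [[a' b'] c'].
  move=> /setIdP[t mt] /setIdP[t' mt'] /= E.
  subst b'; have E : a = a'.
    apply: val_inj => /=; case: (ltngtP a a') => // aa'.
      by case/exists2ordP: mt; exists a', c'; rewrite t'.
    by case/exists2ordP: mt'; exists a, c; rewrite t.
  subst a'; have [_ [a1 [c1 [t1 l1]]] _] := cornerP t.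
  by rewrite -(corner_left t t1 l1) -(corner_left t' t1 l1).
move: card_col card_row (subset_leq_card split2) (card_setU_le colmax rowmax).
rewrite cardsT card_ord; lia.
Qed.

(** The constant is 2 + 4 + 4: corners, then two families in which one end of the base determines
    the other, each bounded by [card_graph]. *)
Lemma card_tame : #|T| <= 10 * n.
Proof.
pose rowmin := [set t in T | ~~ wider_left T t].
pose colmax := [set t in T | ~~ wider_right T t].
have split3 : T \subset corners :|: (rowmin :|: colmax).
  apply/subsetP=> t tT'; rewrite !inE tT' /=.
  by case: wider_left; case: wider_right.
have card_row : #|rowmin| <= 4 * n.
  apply: (@card_graph _ (fun t => t.1.2));
    first by apply/subsetP=> t; rewrite inE => /andP[].
  move=> [[a b] c] [[a' b'] c'] /setIdP[t mt] /setIdP[t' mt'] /= E.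
  subst b'; congr (_, _); apply: val_inj => /=; case: (ltngtP a a') => // aa'.
    by case/exists2ordP: mt'; exists a, c; rewrite t.
  by case/exists2ordP: mt; exists a', c'; rewrite t'.
have card_col : #|colmax| <= 4 * n.
  apply: (@card_graph _ (fun t => t.1.1));
    first by apply/subsetP=> t; rewrite inE => /andP[].
  move=> [[a b] c] [[a' b'] c'] /setIdP[t mt] /setIdP[t' mt'] /= E.
  subst a'; congr (_, _); apply: val_inj => /=; case: (ltngtP b b') => // bb'.
    by case/exists2ordP: mt; exists b', c'; rewrite t'.
  by case/exists2ordP: mt'; exists b, c; rewrite t.
move: card_row card_col card_corners (subset_leq_card split3).
have := card_setU_le corners (rowmin :|: colmax).
have := card_setU_le rowmin colmax; lia.
Qed.

End Tame.

(** * Computing label words from explicit vertex lists *)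

Lemma filter_enum_ord n (P : pred 'I_n) (s : seq 'I_n) :
  sorted (relpre val ltn) s -> P =1 [in s] -> filter P (enum 'I_n) = s.
Proof.
(* Strictly increasing lists with the same members coincide. *)
move=> ss Ps; apply: (@irr_sorted_eq _ (relpre val ltn)) => //.
- by move=> y x z; apply: ltn_trans.
- by move=> x; rewrite /= ltnn.
- apply: sorted_filter; first by move=> y x z; apply: ltn_trans.
  by rewrite -sorted_map val_enum_ord iota_ltn_sorted.
- by move=> x; rewrite mem_filter mem_enum andbT Ps.
Qed.

Lemma rot_enum_ord n (v : 'I_n) :
  rot v.+1 (enum 'I_n) =
  [seq x : 'I_n <- enum 'I_n | v < x] ++
  [seq x : 'I_n <- enum 'I_n | ~~ (v < x)].
Proof.
apply: (inj_map val_inj); rewrite map_rot map_cat.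
rewrite -(filter_map val (fun x => v < x)).
rewrite -(filter_map val (fun x => ~~ (v < x))).
rewrite val_enum_ord /rot.
(* Only the two filtered lists on the right are split, at [v.+1]; each filter then keeps one piece
   whole and empties the other. *)
rewrite -{3 4}(cat_take_drop v.+1 (iota 0 n)) !filter_cat.
have lt_v : all (fun x => ~~ (v < x)) (take v.+1 (iota 0 n)).
  by rewrite take_iota; apply/allP=> x; rewrite mem_iota; lia.
have gt_v : all (fun x => v < x) (drop v.+1 (iota 0 n)).
  by rewrite drop_iota; apply/allP=> x; rewrite mem_iota; lia.
rewrite (all_filterP gt_v) (all_filterP lt_v).
rewrite (eq_in_filter (a2 := pred0)) => [|x /(allP lt_v)/negPf->//].
rewrite (eq_in_filter (a2 := pred0) (s := drop _ _)) => [|x /(allP gt_v)->//].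
by rewrite !filter_pred0 cats0.
Qed.

(** Reading from just after [v] meets the larger vertices [s1] first, then wraps around to the
    smaller ones [s2]; [v] itself would come last and is removed. *)
Lemma word_afterE n (v : 'I_n) (t1 t2 : {set 'I_n}) (s1 s2 : seq 'I_n) :
  sorted (relpre val ltn) s1 -> sorted (relpre val ltn) s2 ->
  all (fun x : 'I_n => v < x) s1 -> all (fun x : 'I_n => x < v) s2 ->
  (t1 :|: t2) :\ v =i s1 ++ s2 ->
  word_after v t1 t2 = [seq x \in t1 | x <- s1 ++ s2].
Proof.
move=> ss1 ss2 /allP gt1 /allP lt2 E.
rewrite /word_after rot_enum_ord filter_cat.
congr (map _ (_ ++ _)); rewrite -filter_predI;
  apply: filter_enum_ord => // x /=.
  rewrite E mem_cat; case s1x: (x \in s1); first by rewrite gt1.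
  by case s2x: (x \in s2) => //=; have := lt2 x s2x; lia.
rewrite E mem_cat; case s2x: (x \in s2).
  by have := lt2 x s2x; rewrite orbT; lia.
by case s1x: (x \in s1) => //=; rewrite gt1.
Qed.

Lemma wordE n (t1 t2 : {set 'I_n}) (s : seq 'I_n) :
  sorted (relpre val ltn) s -> t1 :|: t2 =i s ->
  word t1 t2 = [seq x \in t1 | x <- s].
Proof. by move=> ss E; rewrite /word (filter_enum_ord ss). Qed.

(** * Forbidden configurations recognised from the order of the vertices *)

Definition tri n (a b c : 'I_n) : {set 'I_n} := [set a; b; c].

Lemma nested_apex n (a b a' b' c : 'I_n) :
  a < a' -> a' < b' -> b' < b -> b < c ->
  forms Nested (tri a b c) (tri a' b' c).
Proof.
move=> *; apply/existsP; exists c; apply/andP; split.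
  by apply/eqP/setP=> x; rewrite !inE -!val_eqE /=; lia.
rewrite (@word_afterE _ _ _ _ [::] [:: a; a'; b'; b]) //=; try lia.
  by rewrite !inE !eqseq_cons !eqxx !eqb_id !eqbF_neg -!val_eqE /=; lia.
by move=> x; rewrite !inE -!val_eqE /=; lia.
Qed.

Lemma nested_left n (a b b' c c' : 'I_n) :
  a < b -> b < b' -> b' < c' -> c' < c ->
  forms Nested (tri a b c) (tri a b' c').
Proof.
move=> *; apply/existsP; exists a; apply/andP; split.
  by apply/eqP/setP=> x; rewrite !inE -!val_eqE /=; lia.
rewrite (@word_afterE _ _ _ _ [:: b; b'; c'; c] [::]) //=; try lia.
  by rewrite !inE !eqseq_cons !eqxx !eqb_id !eqbF_neg -!val_eqE /=; lia.
by move=> x; rewrite !inE -!val_eqE /=; lia.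
Qed.

Lemma nested_right n (a a' b c c' : 'I_n) :
  a' < a -> a < b -> b < c -> c < c' ->
  forms Nested (tri a b c) (tri a' b c').
Proof.
move=> *; apply/existsP; exists b; apply/andP; split.
  by apply/eqP/setP=> x; rewrite !inE -!val_eqE /=; lia.
rewrite (@word_afterE _ _ _ _ [:: c; c'] [:: a'; a]) //=; try lia.
  by rewrite !inE !eqseq_cons !eqxx !eqb_id !eqbF_neg -!val_eqE /=; lia.
by move=> x; rewrite !inE -!val_eqE /=; lia.
Qed.

Lemma ears_apart n (a b a' b' c c' : 'I_n) :
  a < b -> b < a' -> a' < b' -> b' < c' -> c' < c ->
  forms Ears (tri a b c) (tri a' b' c').
Proof.
move=> *; apply/andP; split.
  by apply/eqP/setP=> x; rewrite !inE -!val_eqE /=; lia.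
rewrite (@wordE _ _ _ [:: a; b; a'; b'; c'; c]) /=; try lia; last first.
  by move=> x; rewrite !inE -!val_eqE /=; lia.
(* The word is AABBBA, the rotation of AAABBB by one place. *)
by apply/existsP; exists (@Ordinal 6 1 isT);
  rewrite !inE !eqseq_cons !eqxx !eqb_id !eqbF_neg -!val_eqE /=; lia.
Qed.

Lemma david_cross n (a b a' b' c c' : 'I_n) :
  a < a' -> a' < b -> b < b' -> b' < c -> c < c' ->
  forms David (tri a b c) (tri a' b' c').
Proof.
move=> *; apply/andP; split.
  by apply/eqP/setP=> x; rewrite !inE -!val_eqE /=; lia.
rewrite (@wordE _ _ _ [:: a; a'; b; b'; c; c']) /=; try lia; last first.
  by move=> x; rewrite !inE -!val_eqE /=; lia.
by apply/existsP; exists (@Ordinal 6 0 isT);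
  rewrite !inE !eqseq_cons !eqxx !eqb_id !eqbF_neg -!val_eqE /=; lia.
Qed.

(** * From admissible families to tame sets *)

Definition base_apex n (F : {set {set 'I_n}}) : {set triple n} :=
  [set t : triple n | [&& t.1.1 < t.1.2, t.1.2 \in top n,
                        t.2 \in bottom n & tri t.1.1 t.1.2 t.2 \in F]].

Lemma card_base_apex n (F : {set {set 'I_n}}) :
  {in F, forall t, two_top_one_bottom t} -> #|F| <= #|base_apex F|.
Proof.
move=> F21; pose f (t : triple n) := tri t.1.1 t.1.2 t.2.
apply: leq_trans (leq_imset_card f _); apply: subset_leq_card.
apply/subsetP=> t tF.
have /andP[/cards2P[x [y [xy E2]]] /cards1P[c E1]] := F21 t tF.
have Et : t = [set x; y] :|: [set c].
  by rewrite -E2 -E1 -setIUr setUCr setIT.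
have [tx ty] : x \in top n /\ y \in top n.
  have sub : [set x; y] \subset top n by rewrite -E2 subsetIr.
  by split; apply: (subsetP sub); rewrite !inE eqxx ?orbT.
have bc : c \in bottom n.
  have sub : [set c] \subset bottom n by rewrite -E1 subsetIr.
  by apply: (subsetP sub); rewrite inE.
case: (ltngtP x y) => [lt|lt|/val_inj E]; last by rewrite E eqxx in xy.
- by apply/imsetP; exists (x, y, c); rewrite // inE /= lt ty bc /tri -Et.
- apply/imsetP; exists (y, x, c); last by rewrite /f /tri /= [[set y; x]]setUC.
  by rewrite inE /= lt tx bc /tri [[set y; x]]setUC -Et.
Qed.

Lemma tame_base_apex n (F : {set {set 'I_n}}) :
  admissible [:: Nested; Ears; David] F -> tame (base_apex F).
Proof.
move=> /andP[_ /forall_inP F2].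
have memP a b c : (a, b, c) \in base_apex F ->
    [/\ a < b, b < uphalf n, uphalf n <= c & tri a b c \in F].
  by rewrite !inE /= => /and4P[? ?]; rewrite -leqNgt.
(* Admissibility concerns distinct triangles only; a base vertex missing from the other triangle
   certifies distinctness. *)
have avoid a b c a' b' c' : tri a b c \in F -> tri a' b' c' \in F ->
    (a \notin tri a' b' c') || (b \notin tri a' b' c') ->
    [/\ ~~ forms Nested (tri a b c) (tri a' b' c'),
        ~~ forms Ears (tri a b c) (tri a' b' c') &
        ~~ forms David (tri a b c) (tri a' b' c')].
  move=> tF t'F nt; have /forall_inP/(_ _ t'F) := F2 _ tF.
  have -> : tri a b c != tri a' b' c'.
    by apply: contraTneq nt => <-; rewrite !inE !eqxx /= ?orbT.
  by move=> /and4P[].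
split.
- by move=> a b c /memP[].
- move=> a b a' b' c /memP[ab bm cm t] /memP[ab' bm' cm' t'] aa'.
  rewrite leqNgt; apply/negP=> b'b.
  case: (avoid _ _ _ _ _ _ t t') => [|/negP nf _ _]; last apply: nf.
    by rewrite !inE -!val_eqE /=; lia.
  by apply: nested_apex => //; lia.
- move=> a b b' c c' /memP[ab bm cm t] /memP[ab' bm' cm' t'] bb'.
  rewrite leqNgt; apply/negP=> c'c.
  case: (avoid _ _ _ _ _ _ t t') => [|/negP nf _ _]; last apply: nf.
    by rewrite !inE -!val_eqE /=; lia.
  by apply: nested_left => //; lia.
- move=> a a' b c c' /memP[ab bm cm t] /memP[ab' bm' cm' t'] aa'.
  rewrite leqNgt; apply/negP=> c'c.
  (* The order is swapped because [nested_right] takes the triangle with the shorter base first. *)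
  case: (avoid _ _ _ _ _ _ t' t) => [|/negP nf _ _]; last apply: nf.
    by rewrite !inE -!val_eqE /=; lia.
  by apply: nested_right => //; lia.
- move=> a b c a' b' c' /memP[ab bm cm t] /memP[ab' bm' cm' t'] ba'.
  rewrite leqNgt; apply/negP=> c'c.
  case: (avoid _ _ _ _ _ _ t t') => [|_ /negP nf _]; last apply: nf.
    by rewrite !inE -!val_eqE /=; lia.
  by apply: ears_apart => //; lia.
- move=> a b c a' b' c' /memP[ab bm cm t] /memP[ab' bm' cm' t'] aa' a'b bb'.
  rewrite leqNgt; apply/negP=> cc'.
  case: (avoid _ _ _ _ _ _ t t') => [|_ _ /negP nf]; last apply: nf.
    by rewrite !inE -!val_eqE /=; lia.
  by apply: david_cross => //; lia.
Qed.

Lemma ex'_le n : ex' n [:: Nested; Ears; David] <= 10 * n.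
Proof.
apply/bigmax_leqP=> F admF.
have F21 : {in F, forall t, two_top_one_bottom t}.
  by case/andP: admF => /forall_inP F1 _ t /F1/andP[].
exact: leq_trans (card_base_apex F21) (card_tame (tame_base_apex admF)).
Qed.

(* The asymptotic form of the bound *)
From mathcomp Require Import all_classical all_reals all_analysis.
Import GRing.Theory Num.Theory numFieldNormedType.Exports.
Local Open Scope ring_scope.
Local Open Scope classical_set_scope.

Theorem theorem10 (R : realType) :
  (fun n : nat => (ex' n [:: Nested; Ears; David])%:R : R)
    =O_\oo (fun n : nat => n%:R : R).
Proof.
(* The constant comes from [ex'_le], which holds for every [n], so no threshold has to be chosen. *)
apply/eqO_exP; exists 10%:R; first by rewrite ltr0n.
by near=> n; rewrite !normr_nat -natrM ler_nat ex'_le.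
Unshelve. all: by end_near.
Qed.
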